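(* Let $N\ge 1$ be an integer and let $d\ge k\ge 1$ be integers. Then a generic tensor $t\in \mathrm{TNS}(\widetilde G_{2\times N},1,k,d)$ has edge/vertex flattening $$\big((\mathbb{C}^{d})^{\otimes (2N+4)}\big)^{*}\longrightarrow (\mathbb{C}^{k})^{\otimes 2N}$$ of full rank (that is, of rank equal to the minimum of the dimensions of its source and target).
   Context: The graph $\widetilde G_{2\times N}$ (the $2\times N$ grid not on a torus) has $2N$ vertices arranged in 2 rows and $N$ columns: upper vertices $1,\dots,N$ and lower vertices $1',\dots,N'$. Every vertex is incident to exactly five edges: an up edge, a right edge, a down edge, a left edge, and one ''vertex'' dangling edge (a dangling edge is an edge attached to only one vertex). For $1\le p\le N-1$, the right edge of $p$ is the left edge of $p+1$, and the right edge of $p'$ is the left edge of $(p+1)'$; for $1\le p\le N$, the down edge of $p$ is the up edge of $p'$. These shared edges are the entanglement edges. All other up/right/down/left edges (the up edges of $1,\dots,N$, the down edges of $1',\dots,N'$, the left edges of $1,1'$ and the right edges of $N,N'$) are dangling; these $2N+4$ edges are called external physical edges. The $2N$ vertex dangling edges are the non-external physical edges. In total there are $4N+4$ physical (dangling) edges. Unbound tensor network state: let $f$ assign a positive integer $f(e)$ to each edge. To each physical edge $p$ attach a complex vector space $W_p$ of dimension $f(p)$. Orient each entanglement edge (the choice is immaterial). For each vertex $v$ let $\mathbf V_v$ be the tensor product of the spaces $W_p$ over physical edges $p$ at $v$, the spaces $\mathbb{C}^{f(e)}$ over entanglement edges $e$ directed towards $v$, and the dual spaces $(\mathbb{C}^{f(e)})^*$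 over entanglement edges $e$ directed away from $v$. Given tensors $T_v\in\mathbf V_v$, one for each vertex, contracting $\bigotimes_v T_v$ along every entanglement edge (pairing the two factors $\mathbb{C}^{f(e)}$ and $(\mathbb{C}^{f(e)})^*$) gives a tensor $\psi((T_v)_v)\in\bigotimes_p W_p$ (product over physical edges). The set of all tensors so obtained is $\mathrm{TNS}(\widetilde G_{2\times N},f)$. The notation $\mathrm{TNS}(\widetilde G_{2\times N},a,b,c)$ means $\mathrm{TNS}(\widetilde G_{2\times N},f)$ with $f=a$ on entanglement edges, $f=b$ on non-external physical edges and $f=c$ on external physical edges. Edge/vertex flattening: a tensor $t\in X\otimes Y$, where $X$ is the tensor product of the spaces of the $2N+4$ external physical edges and $Y$ is the tensor product of the spaces of the $2N$ non-external physical edges, is regarded as a linear map $X^*\to Y$. Generic: a property holds for a generic $t\in\mathrm{TNS}$ if it holds for $\psi((T_v)_v)$ for all $(T_v)_v$ in some nonempty Zariski open subset of $\bigoplus_v\mathbf V_v$. *)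

(* Defs.v *)
From HB Require Import structures.
From mathcomp Require Import all_boot all_order all_algebra.
From mathcomp Require Import mpoly.

Set Implicit Arguments.
Unset Strict Implicit.
Unset Printing Implicit Defensive.

Import GRing.Theory.
Local Open Scope ring_scope.

(* [mindex n] is the set of multi-indices labelling the standard basis of the
   tensor product over i of C^(n i), and [tensor C n] is that tensor product,
   written in coordinates. *)
Definition mindex (I : finType) (n : I -> nat) : finType :=
  {dffun forall i : I, 'I_(n i)}.

Definition tensor (C : fieldType) (I : finType) (n : I -> nat) : vectType C :=
  {ffun mindex n -> C^o}.

Definition mindex_restr (I : finType) (n : I -> nat) (P : pred I)
    (s : mindex n) : mindex (fun i : {i | P i} => n (val i)) :=
  [ffun i : {i | P i} => s (val i)].

Definition mindex_merge (A B : finType) (n : A + B -> nat)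
    (x : mindex (fun a => n (inl a))) (y : mindex (fun b => n (inr b))) :
    mindex n :=
  [ffun p : A + B => match p return 'I_(n p) with
                     | inl a => x a
                     | inr b => y b
                     end].

(* The flattening of t in X (x) Y, where X and Y are the tensor products over
   A and over B: a linear form phi on X is sent to (phi (x) id_Y) t. *)
Section Flattening.
Variables (C : fieldType) (A B : finType) (n : A + B -> nat).
Let X := tensor C (fun a => n (inl a)).
Let Y := tensor C (fun b => n (inr b)).

Definition flattening_fun (t : tensor C n) (phi : 'Hom(X, C^o)) : Y :=
  [ffun y => phi [ffun x => t (mindex_merge x y)]].

Fact flattening_fun_is_linear t : linear (flattening_fun t).
Proof.
by move=> c phi psi; apply/ffunP => y; rewrite !ffunE add_lfunE scale_lfunE.
Qed.

HB.instance Definition _ t :=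
  GRing.isLinear.Build C 'Hom(X, C^o) Y _ (flattening_fun t)
    (flattening_fun_is_linear t).

Definition flattening (t : tensor C n) : 'Hom('Hom(X, C^o), Y) :=
  linfun (flattening_fun t).

End Flattening.

Definition full_rank (C : fieldType) (U V : vectType C) (h : 'Hom(U, V)) :=
  \dim (limg h) = minn (\dim {:U}) (\dim {:V}).

(* Every entanglement edge is oriented from [src] to [tgt]; every physical edge
   is attached to the single vertex [anchor]. *)
Record network := Network {
  vertex : finType;
  ent : finType;
  phys : finType;
  src : ent -> vertex;
  tgt : ent -> vertex;
  anchor : phys -> vertex
}.

Definition edge (G : network) : finType := (ent G + phys G)%type.

Section TensorNetwork.
Variables (C : fieldType) (G : network) (f : edge G -> nat).

Definition ent_dim (e : ent G) : nat := f (inl e).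
Definition phys_dim (p : phys G) : nat := f (inr p).

(* The three factors range over the physical edges at v, the entanglement edges
   directed towards v, and those directed away from v; on the last factor, the
   basis of the dual spaces is the dual of the standard basis. *)
Definition site_index (v : vertex G) : finType :=
  (mindex (fun p : {p | anchor p == v} => phys_dim (val p)) *
   mindex (fun e : {e | tgt e == v} => ent_dim (val e)) *
   mindex (fun e : {e | src e == v} => ent_dim (val e)))%type.

Definition site_space (v : vertex G) : vectType C :=
  {ffun site_index v -> C^o}.

Definition site_restr (s : mindex phys_dim) (g : mindex ent_dim)
    (v : vertex G) : site_index v :=
  (mindex_restr (fun p => anchor p == v) s,
   mindex_restr (fun e => tgt e == v) g,
   mindex_restr (fun e => src e == v) g).

(* The sum over g pairs the two factors attached to each entanglement edge. *)
Definition contract (T : forall v, site_space v) : tensor C phys_dim :=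
  [ffun s => \sum_(g : mindex ent_dim) \prod_v T v (site_restr s g v)].

Definition coord_index : finType := {v : vertex G & site_index v}.

Definition coords (T : forall v, site_space v) (i : 'I_#|coord_index|) : C :=
  T (tag (enum_val i)) (tagged (enum_val i)).

Definition zariski_open (U : (forall v, site_space v) -> Prop) : Prop :=
  exists S : {mpoly C[#|coord_index|]} -> Prop,
    forall T, U T <-> exists2 q, S q & q.@[coords T] != 0.

Definition generic_TNS (P : tensor C phys_dim -> Prop) : Prop :=
  exists U : (forall v, site_space v) -> Prop,
    [/\ zariski_open U, exists T, U T & forall T, U T -> P (contract T)].

End TensorNetwork.

Arguments generic_TNS C {G} f P.

(* The 2 x N grid. The vertex (r, p) lies in row r, where [false] is the upper
   and [true] the lower row, and in column p, numbered from 0. *)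
Section Grid.
Variables (N : nat) (hN : (0 < N)%N).

Definition grid_vertex : finType := (bool * 'I_N)%type.

(* [inl (r, p)] is the right edge of (r, p), that is, the left edge of
   (r, p.+1); [inr p] is the down edge of the upper vertex p, that is, the up
   edge of the lower vertex p. *)
Definition grid_ent : finType := ((bool * 'I_N.-1) + 'I_N)%type.

(* [inl (r, p)] is the up edge of (r, p) if r is the upper row, and its down
   edge if r is the lower row; [inr (r, false)] is the left edge of row r, and
   [inr (r, true)] its right edge. *)
Definition grid_ext : finType := ((bool * 'I_N) + (bool * bool))%type.

(* The non-external physical edges are labelled by the vertex they hang on. *)
Definition grid_phys : finType := (grid_ext + grid_vertex)%type.

Fact grid_succ_subproof (p : 'I_N.-1) : (p.+1 < N)%N.
Proof. by rewrite -ltn_predRL ltn_ord. Qed.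

Fact grid_last_subproof : (N.-1 < N)%N.
Proof. by rewrite ltn_predL. Qed.

Definition grid_src (e : grid_ent) : grid_vertex :=
  match e with
  | inl (r, p) => (r, widen_ord (leq_pred N) p)
  | inr p => (false, p)
  end.

Definition grid_tgt (e : grid_ent) : grid_vertex :=
  match e with
  | inl (r, p) => (r, Ordinal (grid_succ_subproof p))
  | inr p => (true, p)
  end.

Definition grid_anchor (p : grid_phys) : grid_vertex :=
  match p with
  | inl (inl v) => v
  | inl (inr (r, false)) => (r, Ordinal hN)
  | inl (inr (r, true)) => (r, Ordinal grid_last_subproof)
  | inr v => v
  end.

Definition grid : network := Network grid_src grid_tgt grid_anchor.

Definition grid_dims (a b c : nat) (e : edge grid) : nat :=
  match e with
  | inl _ => a
  | inr (inl _) => c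
  | inr (inr _) => b
  end.

End Grid.

Arguments grid_dims {N} hN a b c e.

(* A physical multi-index of the grid is indexed by [grid_ext + grid_vertex], so
   [flattening] splits external from non-external physical edges. *)
Definition edge_vertex_flattening (C : fieldType) (N : nat) (hN : (0 < N)%N)
    (f : edge (grid hN) -> nat) (t : tensor C (phys_dim f)) :=
  @flattening C (grid_ext N) (grid_vertex N) (phys_dim f) t.

(* Main.v *)
From HB Require Import structures.
Require Import Defs.
From mathcomp Require Import all_boot all_algebra.
From mathcomp Require Import mpoly.
From mathcomp Require Import reals complex.

(** When every entanglement edge has dimension 1, the flattening of
    [contract T] is the Kronecker product over the vertices v of the local
    flattenings of the T v.  Every vertex carries at least one external edge, of
    dimension d >= k, so each local flattening is generically onto C^k; hence
    the whole flattening is generically surjective, and a surjective map has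
    full rank.

    To exhibit the open set, fix a map [xs] from the basis of the target to
    the basis of the source, and consider the square submatrix of the
    flattening cut out by the columns [xs y].  Its determinant is a polynomial
    in the entries of T ([flattening_minor_polyE]), and where it does not vanish
    the flattening is onto ([full_rank_flattening]).  This holds for any tensor
    network whose physical edges are split in two, so genericity reduces to
    finding one T with a nonzero minor ([generic_full_rank_flattening]).  On the
    grid, take for [xs y] the multi-index that copies y v on the vertical
    external edge of v, and is 0 on the other external edges; and for T v the
    Kronecker delta between the vertical external edge and the vertex edge
    of v ([delta_site]).  The submatrix is then the identity. *)

Set Implicit Arguments.
Unset Strict Implicit.
Unset Printing Implicit Defensive.

Import GRing.Theory.
Local Open Scope ring_scope.

(** * Full rank from a nonzero minor *)

Lemma full_rank_surj (C : fieldType) (U V : vectType C) (h : 'Hom(U, V)) :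
  (forall v, exists u, h u = v) -> full_rank h.
Proof.
move=> surj.
have limgT : limg h = fullv.
  apply/eqP; rewrite eqEsubv subvf; apply/subvP => v _.
  by have [u <-] := surj v; rewrite memv_img ?memvf.
rewrite /full_rank limgT; apply/esym/minn_idPr.
by rewrite -limgT -(limg_ker_dim h fullv) leq_addl.
Qed.

Section FlatteningMinor.
Variables (C : fieldType) (A B : finType) (n : A + B -> nat).

Let indX := mindex (fun a => n (inl a)).
Let indY := mindex (fun b => n (inr b)).

Definition flattening_minor (t : tensor C n) (xs : indY -> indX) :
    'M[C]_#|indY| :=
  \matrix_(i, j) t (mindex_merge (xs (enum_val j)) (enum_val i)).

Definition sample_form (xs : indY -> indX) (c : 'cV[C]_#|indY|)
    (u : tensor C (fun a => n (inl a))) : C^o :=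
  \sum_j u (xs (enum_val j)) * c j 0.

Fact sample_form_is_linear xs c : linear (sample_form xs c).
Proof.
move=> a u v; rewrite /sample_form scaler_sumr -big_split /=.
by apply: eq_bigr => j _; rewrite !ffunE mulrDl -scalerAl.
Qed.

HB.instance Definition _ xs c :=
  GRing.isLinear.Build C (tensor C (fun a => n (inl a))) C^o _
    (sample_form xs c) (sample_form_is_linear xs c).

(** The flattening sends the form [u |-> \sum_j u (xs j) * c_j] to the vector
    [M c], where M is the minor; so it is onto as soon as M is invertible. *)
Lemma full_rank_flattening (t : tensor C n) (xs : indY -> indX) :
  \det (flattening_minor t xs) != 0 -> full_rank (flattening t).
Proof.
move=> detM; apply: full_rank_surj => w.
pose M := flattening_minor t xs.
pose wc : 'cV[C]_#|indY| := \col_i w (enum_val i).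
exists (linfun (sample_form xs (invmx M *m wc))).
rewrite lfunE; apply/ffunP => y; rewrite ffunE lfunE /= /sample_form.
have <- : (M *m (invmx M *m wc)) (enum_rank y) 0 = w y.
  by rewrite mulKVmx ?unitmxE ?unitfE // mxE enum_rankK.
by rewrite [RHS]mxE; apply: eq_bigr => j _; rewrite !mxE !ffunE enum_rankK.
Qed.

End FlatteningMinor.

(** * Minors of a tensor network state are polynomial *)

Section GenericMinor.
Variables (C : fieldType) (V E A B : finType).
Variables (s t : E -> V) (an : A + B -> V).
Let G := Network s t an.
Variable f : edge G -> nat.

Let indX := mindex (fun a : A => phys_dim f (inl a)).
Let indY := mindex (fun b : B => phys_dim f (inr b)).

Definition flattening_minor_poly (xs : indY -> indX) :
    {mpoly C[#|coord_index f|]} :=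
  \det (\matrix_(i < #|indY|, j < #|indY|)
    \sum_(g : mindex (ent_dim f)) \prod_(v : V)
      'X_(enum_rank (Tagged (site_index f)
        (@site_restr G f (mindex_merge (xs (enum_val j)) (enum_val i)) g v)))).

(** Each entry of the minor is an entry of the state, hence a sum of products of
    entries of the site tensors; evaluation is a ring morphism, so it commutes
    with the determinant. *)
Lemma flattening_minor_polyE xs (T : forall v : V, @site_space C G f v) :
  (flattening_minor_poly xs).@[@coords C G f T] =
  \det (flattening_minor (@contract C G f T : @tensor C (A + B)%type _) xs).
Proof.
rewrite /flattening_minor_poly -det_map_mx; congr (\det _).
apply/matrixP => i j; rewrite !mxE ffunE rmorph_sum /=.
apply: eq_bigr => g _; rewrite rmorph_prod /=.
by apply: eq_bigr => v _; rewrite mevalXU /coords enum_rankK.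
Qed.

(** The nonvanishing locus of the minor is a Zariski open set on which the
    flattening has full rank; a single T0 shows that it is nonempty. *)
Lemma generic_full_rank_flattening xs (T0 : forall v : V, @site_space C G f v) :
  \det (flattening_minor (@contract C G f T0 : @tensor C (A + B)%type _) xs)
    != 0 ->
  generic_TNS C f (fun t => full_rank (@flattening C A B (phys_dim f) t)).
Proof.
move=> T0P.
exists (fun T => (flattening_minor_poly xs).@[@coords C G f T] != 0); split.
- exists (eq (flattening_minor_poly xs)) => T.
  by split=> [nz | [_ <-]//]; exists (flattening_minor_poly xs).
- by exists T0; rewrite flattening_minor_polyE.
- by move=> T; rewrite flattening_minor_polyE; apply: full_rank_flattening.
Qed.

End GenericMinor.

(** * A grid state whose minor is the identity *)

Section GridWitness.
Variables (C : fieldType) (N d k : nat).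
Hypotheses (hN : (0 < N)%N) (hk : (0 < k)%N) (hkd : (k <= d)%N).

Let f := grid_dims hN 1 k d.
Let indX := mindex (fun a : grid_ext N => phys_dim f (inl a)).
Let indY := mindex (fun b : grid_vertex N => phys_dim f (inr b)).

(** The hypothesis [k <= d] is what lets one external edge of v carry all
    values of y v. *)
Definition vertical_index (y : indY) : indX :=
  [ffun a : grid_ext N => match a return 'I_(phys_dim f (inl a)) with
    | inl v => widen_ord hkd (y v)
    | inr _ => Ordinal (leq_trans hk hkd)
    end].

Definition delta_site (v : vertex (grid hN)) : site_space C f v :=
  [ffun x : site_index f v =>
    (val (x.1.1 (exist (fun p : phys (grid hN) => anchor p == v)
                       (inl (inl v)) (eqxx v))) ==
     val (x.1.1 (exist (fun p : phys (grid hN) => anchor p == v)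
                       (inr v) (eqxx v))))%:R].

(** Contracting edges of dimension 1 is a sum with a single term. *)
Lemma card_mindex_ent : #|mindex (ent_dim f)| = 1%N.
Proof.
apply/eqP/fintype1P; exists [ffun e => ord0 : 'I_(ent_dim f e)] => g.
by apply/ffunP => e; rewrite !ffunE [LHS]ord1.
Qed.

(** The (y', y) entry is the product over v of the local deltas between y v and
    y' v, which is 1 exactly when y = y'. *)
Lemma delta_site_minor :
  flattening_minor
    (contract delta_site : @tensor C (grid_ext N + grid_vertex N)%type _)
    vertical_index = 1%:M.
Proof.
apply/matrixP => i j; rewrite !mxE ffunE.
set yi := enum_val i; set yj := enum_val j.
under eq_bigr => g _.
  under eq_bigr => v _ do rewrite !ffunE /= !ffunE /=.
  over.
rewrite sumr_const card_mindex_ent mulr1n.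
rewrite -(inj_eq enum_val_inj) -/yi -/yj.
have [-> | neq_y] := eqVneq yi yj.
  by rewrite big1 // => v _; rewrite eqxx.
have /existsP[v /negPf neq_v] : [exists v, (yj v : nat) != (yi v : nat)].
  apply: contraR neq_y; rewrite negb_exists => /forallP eq_y.
  by apply/eqP/ffunP => v; have /negPn/eqP/val_inj -> := eq_y v.
by rewrite (bigD1 v) //= neq_v mul0r.
Qed.

End GridWitness.

Local Open Scope complex_scope.

Theorem theorem1p5 (R : realType) (N d k : nat)
    (hN : (1 <= N)%N) (hk : (1 <= k)%N) (hkd : (k <= d)%N) :
  generic_TNS R[i] (grid_dims hN 1 k d)
    (fun t => full_rank (edge_vertex_flattening t)).
Proof.
apply: (@generic_full_rank_flattening _ _ _ _ _ _ _ _ _ (vertical_index hk hkd)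
  (@delta_site R[i] N d k hN)).
by rewrite delta_site_minor det1 oner_neq0.
Qed.
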